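(* Let $\tau\in[0,1]$, $\nu\in\mathbb{R}$ and $N\in\mathbb{N}$ (positive integer). Then the following identities hold for all $z,w\in\mathbb{C}$. (i) (Complex ensemble) Let $$\mathcal{K}_N^{(\nu)}(z,w):=\sum_{j=0}^{N-1}\frac{j!\,\tau^{2j}}{\Gamma(j+\nu+1)}L_j^{(\nu)}\Bigl(\frac z\tau\Bigr)L_j^{(\nu)}\Bigl(\frac w\tau\Bigr).$$ Then $$\bigg[(1-\tau^2)\,z\,\partial_z^2+\Big((1-\tau^2)(\nu+1)+2\tau z\Big)\partial_z+\frac{\tau^2z-w}{1-\tau^2}+(\nu+1)\tau\bigg]\mathcal{K}_N^{(\nu)}(z,w)$$ $$=\frac{N!}{\Gamma(N+\nu)}\frac{\tau^{2N-1}}{1-\tau^2}\bigg[L_{N-1}^{(\nu)}\Bigl(\frac z\tau\Bigr)L_N^{(\nu)}\Bigl(\frac w\tau\Bigr)-\tau^2L_N^{(\nu)}\Bigl(\frac z\tau\Bigr)L_{N-1}^{(\nu)}\Bigl(\frac w\tau\Bigr)\bigg].$$ (ii) (Symplectic ensemble) Let $\kappa_N^{(\nu)}(z,w):=G_N(z,w)-G_N(w,z)$, where $$G_N(z,w):=-\frac{\sqrt\pi}{2^{2\nu+1}}\sum_{k=0}^{N-1}\sum_{j=0}^{k}\frac{(2k)!!\,\tau^{2k+1}}{2^k\,\Gamma(k+\nu+3/2)}\,\frac{(2j-1)!!\,\tau^{2j}}{2^j\,\Gamma(j+\nu+1)}\,L_{2k+1}^{(2\nu)}\Bigl(\frac z\tau\Bigr)L_{2j}^{(2\nu)}\Bigl(\frac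 w\tau\Bigr).$$ Then $$\bigg[(1-\tau^2)\,z\,\partial_z^2+\Big((2\nu+1)(1-\tau^2)+2\tau z\Big)\partial_z+\tau(2\nu+1)-z\bigg]\kappa_N^{(\nu)}(z,w)$$ $$=\mathcal{K}_{2N}^{(2\nu)}(z,w)-\frac{\sqrt\pi\,N!\,\tau^{2N}}{2^{2\nu}\,\Gamma(N+\nu+1/2)}\,L_{2N}^{(2\nu)}\Bigl(\frac z\tau\Bigr)\sum_{j=0}^{N-1}\frac{(2j-1)!!\,\tau^{2j}}{2^j\,\Gamma(j+\nu+1)}L_{2j}^{(2\nu)}\Bigl(\frac w\tau\Bigr).$$
   Context: $L_j^{(\nu)}(z):=\sum_{k=0}^{j}\frac{\Gamma(j+\nu+1)}{(j-k)!\,\Gamma(\nu+k+1)}\frac{(-z)^k}{k!}$ is the generalised Laguerre polynomial. The coefficients $\Gamma(j+\nu+1)/\Gamma(\nu+k+1)=(\nu+k+1)(\nu+k+2)\cdots(\nu+j)$ are polynomial in $\nu$, so $L_j^{(\nu)}$ makes sense for all real $\nu$, and $1/\Gamma$ is understood as the entire reciprocal Gamma function (zero at non-positive integers). Double factorials: $(2k)!!=2^kk!$, $(2j-1)!!=1\cdot3\cdots(2j-1)$ with $(-1)!!=0!!=1$. Conventions at the endpoints of $\tau$: for $\tau=0$, all expressions are read by continuity in $\tau$ (each product $\tau^jL_j^{(\nu)}(z/\tau)$ is a polynomial in $\tau$ and $z$); for $\tau=1$, the identity in (i) is read after multiplying both sides by $1-\tau^2$. *)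

(* Defs.v *)
From mathcomp Require Import all_boot all_order all_algebra.
From mathcomp Require Import complex.
From mathcomp Require Import all_classical all_reals all_analysis.

Set Implicit Arguments.
Unset Strict Implicit.
Unset Printing Implicit Defensive.

Import Order.TTheory GRing.Theory Num.Theory.
Import numFieldNormedType.Exports.

Local Open Scope ring_scope.
Local Open Scope complex_scope.

(* The complex derivative; R[i] is seen as a normed module over itself. *)
Definition cderive (R : realType) (f : R[i] -> R[i]) : R[i] -> R[i] :=
  derive1 (f : R[i] -> (R[i])^o).

(* The reciprocal Gamma function on the whole real line, by the Gauss-Euler
   product 1/Gamma(x) = lim_n x(x+1)...(x+n) / (n! n^x).  It converges for
   every real x, and vanishes exactly at the non-positive integers. *)
Definition rGamma (R : realType) (x : R) : R :=
  limn (fun n : nat =>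
    (\prod_(i < n.+1) (x + i%:R)) / (n`!%:R * n%:R `^ x) : R).

(* The double factorial n!!.  With truncated subtraction, dfact (2 * j - 1)
   is dfact 0 = 1 for j = 0, i.e. the convention (-1)!! = 1. *)
Fixpoint dfact (n : nat) : nat :=
  if n is n'.+2 then (n * dfact n')%N else 1%N.

(* Gamma(j+nu+1) / ((j-k)! Gamma(nu+k+1) k!), the quotient of Gamma values
   being the product (nu+k+1)(nu+k+2)...(nu+j), polynomial in nu. *)
Definition laguerre_coef (R : realType) (nu : R) (j k : nat) : R :=
  (\prod_(k <= i < j) (nu + i.+1%:R)) / ((j - k)`!%:R * k`!%:R).

Definition laguerre (R : realType) (nu : R) (j : nat) (z : R[i]) : R[i] :=
  \sum_(k < j.+1) (laguerre_coef nu j k)%:C * (- z) ^+ k.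

(* The product tau^j L_j^(nu)(z/tau), written as a polynomial in tau and z;
   this gives the value by continuity at tau = 0.  See hlaguerreE. *)
Definition hlaguerre (R : realType) (tau nu : R) (j : nat) (z : R[i]) : R[i] :=
  \sum_(k < j.+1) (laguerre_coef nu j k)%:C * tau%:C ^+ (j - k) * (- z) ^+ k.

Lemma hlaguerreE (R : realType) (tau nu : R) (j : nat) (z : R[i]) :
  tau != 0 ->
  hlaguerre tau nu j z = tau%:C ^+ j * laguerre nu j (z / tau%:C).
Proof.
move=> tau0; have t0 : tau%:C != 0 by rewrite -[0]/(0%:C) (inj_eq (@complexI R)).
rewrite /hlaguerre /laguerre big_distrr /=; apply: eq_bigr => k _.
have kj : (k <= j)%N by rewrite -ltnS.
have tE : tau%:C ^+ j = tau%:C ^+ (j - k) * tau%:C ^+ k by rewrite -exprD subnK.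
rewrite -mulNr expr_div_n tE mulrCA -!mulrA; congr (_ * (_ * _)).
by rewrite mulrCA mulfV ?mulr1// expf_neq0.
Qed.

(* The factor tau^(2j) is split between the two Laguerre polynomials. *)
Definition cKernel (R : realType) (tau nu : R) (N : nat) (z w : R[i]) : R[i] :=
  \sum_(j < N) (j`!%:R * rGamma (j%:R + nu + 1))%:C
    * (hlaguerre tau nu j z * hlaguerre tau nu j w).

Definition preKernel (R : realType) (tau nu : R) (N : nat) (z w : R[i]) : R[i] :=
  - (Num.sqrt pi / 2 `^ (2 * nu + 1))%:C *
  \sum_(k < N) \sum_(j < k.+1)
     ((dfact (2 * k))%:R / 2 ^+ k * rGamma (k%:R + nu + 3 / 2))%:C
   * ((dfact (2 * j - 1))%:R / 2 ^+ j * rGamma (j%:R + nu + 1))%:C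
   * (hlaguerre tau (2 * nu) (2 * k + 1) z * hlaguerre tau (2 * nu) (2 * j) w).

Definition sKernel (R : realType) (tau nu : R) (N : nat) (z w : R[i]) : R[i] :=
  preKernel tau nu N z w - preKernel tau nu N w z.

(* Main.v *)
Require Import Defs.
From mathcomp Require Import all_boot all_order all_algebra.
From mathcomp Require Import complex.
From mathcomp Require Import all_classical all_reals all_analysis.
From mathcomp Require Import ring lra zify.

(** Both identities are telescoping sums. Let a be the Laguerre parameter,
nu in (i) and 2 nu in (ii), and let H_j(z) = tau^j L_j^(a)(z/tau), a polynomial
in tau and z, so that tau = 0 needs no separate treatment. The operator
  D = (1 - tau^2) z d^2 + ((a + 1) (1 - tau^2) + 2 tau z) d + tau (a + 1) - z
shifts the degree by one in both directions ([laguerre_op_cpoly]):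
  D H_j = (j + 1) H_{j+1} - (j + a) H_{j-1}.
This combines the action of z d on H_j ([laguerre_poly_euler]), that of
z d^2 + (a + 1) d ([laguerre_poly_lower]) and the three-term recurrence
([laguerre_cpoly_three_term]); each reduces to a relation between two or three
Laguerre coefficients.

In (i), multiplied by 1 - tau^2, the operator is
(1 - tau^2) (D + z) + tau^2 z - w. By the three-term recurrence in z and in w it
turns the j-th summand into a difference E_{j+1} - E_j, where
  E_j = d_j (H_{j-1}(z) H_j(w) - tau^2 H_j(z) H_{j-1}(w)),
because the weight c_j = j! / Gamma(j + nu + 1) satisfies
  (j + 1) c_j = (j + 1)! / Gamma(j + nu + 1),   (j + nu) c_j = j! / Gamma(j + nu),
that is, the coefficient d_j = j! / Gamma(j + nu) at j + 1 and at j
([cKernel_poly_identity]).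

In (ii), the weights of the odd and of the even polynomials make D telescope
along each of the two sums. What survives from G_N(z,w) is the boundary term of
the statement and a diagonal of even indices; what survives from G_N(w,z) is a
diagonal of odd indices ([laguerre_op_even_sum], [sKernel_poly_identity]). The
two diagonals interlace to the complex kernel of size 2N by the duplication
formula
  1/Gamma(x) 1/Gamma(x + 1/2) = 2^(2x) / (2 sqrt pi) 1/Gamma(2x).

The analytic input is therefore the functional equation and the duplication
formula of the Gauss product for 1/Gamma, for every real argument. For x >= 0
the products decrease, hence converge; the functional equation, which holds
for the finite products up to a factor tending to 1, carries convergence to
all real x ([is_cvg_gauss_product], [rGamma_shift]). The duplication formula
also holds for finite products up to elementary factors, and its constant is
the Wallis limit ([cvg_wallis], [rGamma_duplication]). *)

Import Order.TTheory GRing.Theory Num.Theory.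
Import numFieldNormedType.Exports.

Local Open Scope ring_scope.
Local Open Scope complex_scope.

(** * Wallis integrals *)

Section Wallis.
Local Open Scope classical_set_scope.
Local Open Scope ring_scope.
Context {R : realType}.

(** The recursion is the reduction formula for the integral of sin^n. An explicit
primitive replaces the integral: only its derivative and its values at the end
points enter. *)
Fixpoint sin_expn_primitive (n : nat) (x : R) : R :=
  match n with
  | 0 => x
  | 1 => - cos x
  | n'.+2 => (n'.+1%:R * sin_expn_primitive n' x - cos x * sin x ^+ n'.+1) / n'.+2%:R
  end.

Lemma nat_ind2 (P : nat -> Prop) :
  P 0%N -> P 1%N -> (forall n, P n -> P n.+2) -> forall n, P n.
Proof.
move=> P0 P1 PS n; suff [] : P n /\ P n.+1 by [].
by elim: n => [//|n [Pn Pn1]]; split=> //; exact: PS.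
Qed.

Lemma is_derive_sin_expn_primitive n (x : R) :
  is_derive x 1 (sin_expn_primitive n) (sin x ^+ n).
Proof.
elim/nat_ind2: n => [||n IHn].
- rewrite expr0; exact: is_derive_id.
- rewrite expr1 -[sin x]opprK; exact: (is_deriveN (is_derive_cos x)).
- have dcs := is_deriveM (is_derive_cos x) (is_deriveX n.+1 (is_derive_sin x)).
  have d1 := is_deriveB (is_deriveZ n.+1%:R IHn) dcs.
  have d2 := is_deriveZ n.+2%:R^-1 d1.
  have -> : sin_expn_primitive n.+2 =
      n.+2%:R^-1 \*: (n.+1%:R \*: sin_expn_primitive n
        - cos * (@sin R : R -> R^o) ^+ n.+1).
    by apply/funext => y; rewrite /= mulrC !fctE.
  apply: (is_derive_eq d2).
  rewrite /GRing.scale /= exprfctE exprS.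
  have n2 : n.+2%:R != 0 :> R by rewrite pnatr_eq0.
  apply: (mulfI n2); rewrite mulVKf//.
  have -> : n.+2%:R = n.+1%:R + 1 :> R by rewrite -natr1.
  by have := cos2sin2 x; rewrite expr2 !exprS => cE; ring: cE.
Qed.

(** The integral of sin^n over [0, pi/2]. *)
Definition wallis (n : nat) : R :=
  sin_expn_primitive n (pi / 2) - sin_expn_primitive n 0.

Lemma wallisSS n : wallis n.+2 = n.+1%:R / n.+2%:R * wallis n.
Proof.
rewrite /wallis /= cos_pihalf sin0 mul0r expr0n mulr0 !subr0.
by rewrite mulrBr mulrAC [X in _ - X]mulrAC.
Qed.

Lemma wallis0 : wallis 0 = pi / 2.
Proof. by rewrite /wallis /= subr0. Qed.

Lemma wallis1 : wallis 1 = 1.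
Proof. by rewrite /wallis /= cos_pihalf cos0 oppr0 sub0r opprK. Qed.

Lemma wallis_gt0 n : 0 < wallis n.
Proof.
elim/nat_ind2: n => [||n IHn].
- by rewrite wallis0 divr_gt0// pi_gt0.
- by rewrite wallis1.
- by rewrite wallisSS mulr_gt0// divr_gt0.
Qed.

(** On [0, pi/2] the derivative sin^n - sin^(n+1) of the difference of the two
primitives is nonnegative. *)
Lemma wallis_nincr n : wallis n.+1 <= wallis n.
Proof.
pose f (y : R) : R := sin_expn_primitive n y - sin_expn_primitive n.+1 y.
have df (x : R) : is_derive x 1 f (sin x ^+ n - sin x ^+ n.+1).
  exact: is_deriveB (is_derive_sin_expn_primitive n x)
    (is_derive_sin_expn_primitive n.+1 x).
suff : f 0 <= f (pi / 2) by rewrite /f /wallis; lra.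
have pi2 : 0 <= pi / 2 :> R by rewrite divr_ge0 ?pi_ge0.
apply: (@ger0_derive1_ndecr _ f 0 (pi / 2)) => //.
- move=> x; rewrite in_itv/= => /andP[x0 xpi]; rewrite derive1E derive_val.
  rewrite exprS -{1}[sin x ^+ n]mul1r -mulrBl mulr_ge0 ?subr_ge0 ?sin_le1//.
  by rewrite exprn_ge0// sin_ge0_pi//; lra.
- apply: continuous_subspaceT => x.
  by apply/differentiable_continuous/derivable1_diffP; exact: ex_derive.
Qed.

Lemma wallis_mul n : wallis n * wallis n.+1 = pi / 2 / n.+1%:R.
Proof.
elim: n => [|n IHn]; first by rewrite wallis0 wallis1 mulr1 divr1.
rewrite wallisSS mulrCA [X in _ * X]mulrC IHn -!natr1.
have n0 := ler0n R n; field.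
by apply/andP; split; apply/lt0r_neq0; lra.
Qed.

Lemma wallis_odd n :
  wallis n.*2.+1 = (4 ^ n * n`! ^ 2)%:R / (n.*2.+1)`!%:R.
Proof.
elim: n => [|n IHn]; first by rewrite wallis1 divr1.
rewrite doubleS wallisSS IHn 3!factS !expnS !expn0 !natrM -addnn -!natr1 !natrD.
have n0 := ler0n R n.
have f0 : (n + n)`!%:R != 0 :> R by rewrite pnatr_eq0 -lt0n fact_gt0.
field.
by rewrite f0 /=; apply/and3P; split; apply/lt0r_neq0; lra.
Qed.

Lemma cvg_invn : (n%:R^-1 : R) @[n --> \oo] --> (0 : R).
Proof. by rewrite -cvg_shiftS; exact: cvg_harmonic. Qed.

(** By monotonicity W_{2n+1}^2 lies between W_{2n+1} W_{2n+2} and W_{2n} W_{2n+1},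
both of which are known in closed form. *)
Lemma cvg_wallis : (n%:R * wallis n.*2.+1 ^+ 2) @[n --> \oo] --> (pi / 4 : R).
Proof.
have wE m : wallis m > 0 by exact: wallis_gt0.
have lim c : pi / 4 / (1 + c / 2 * n%:R^-1) @[n --> \oo] --> (pi / 4 : R).
  rewrite -[X in _ --> X]mulr1; apply: cvgMl_tmp. rewrite -[X in _ --> X]invr1.
  apply: cvgV; first exact: oner_neq0.
  rewrite -[X in _ --> X]addr0; apply: cvgD; first exact: cvg_cst.
  rewrite -(mulr0 (c/2)); apply: cvgMl_tmp; exact: cvg_invn.
(* For c = 2 and c = 1 these are n W_{2n+1} W_{2n+2} and n W_{2n} W_{2n+1}. *)
apply: (squeeze_cvgr _ (lim 2) (lim 1)).
near=> n.
have n0 : 0 < n%:R :> R by rewrite ltr0n; near: n; exact: nbhs_infty_gt.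
have := wallis_mul n.*2; have := wallis_mul n.*2.+1.
have := wallis_nincr n.*2; have := wallis_nincr n.*2.+1.
have := wE n.*2.+1.
move: (wallis n.*2) (wallis n.*2.+1) (wallis n.*2.+2) => a b c.
have e1 : n.*2.+1%:R = 2 * n%:R + 1 :> R by rewrite -natr1 -mul2n natrM.
rewrite -[n.*2.+2%:R]natr1 e1 => b0 cb ba bc ab.
have -> : pi / 4 / (1 + 2 / 2 / n%:R) = n%:R * (b * c) :> R.
  by rewrite bc; field; do ?[apply/andP; split]; apply/lt0r_neq0; lra.
have -> : pi / 4 / (1 + 1 / 2 / n%:R) = n%:R * (a * b) :> R.
  by rewrite ab; field; do ?[apply/andP; split]; apply/lt0r_neq0; lra.
by apply/andP; split; rewrite ler_pM2l// expr2 ?ler_pM2l// ler_pM2r.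
Unshelve. all: by end_near. Qed.
End Wallis.

(** * The reciprocal Gamma function *)

Section ReciprocalGamma.
Local Open Scope classical_set_scope.
Local Open Scope ring_scope.
Context {R : realType}.
Implicit Type x : R.

(** The sequence whose limit is [rGamma x]. *)
Definition gauss_product x (n : nat) : R :=
  (\prod_(i < n.+1) (x + i%:R)) / (n`!%:R * n%:R `^ x).

(** The functional equation before passing to the limit; the extra factor tends
to 1. *)
Lemma gauss_product_shift x n : (0 < n)%N ->
  gauss_product x n * (1 + (x + 1) * n%:R^-1) = x * gauss_product (x + 1) n.
Proof.
move=> n0; have n0' : n%:R != 0 :> R by rewrite pnatr_eq0 -lt0n.
have px : n%:R `^ x != 0 :> R by rewrite powR_eq0 (negbTE n0').
have f0 : n`!%:R != 0 :> R by rewrite pnatr_eq0 -lt0n fact_gt0.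
have E : x * \prod_(i < n.+1) (x + 1 + i%:R) =
    (\prod_(i < n.+1) (x + i%:R)) * (x + n.+1%:R).
  transitivity (\prod_(i < n.+2) (x + i%:R)); last by rewrite big_ord_recr.
  rewrite [RHS]big_ord_recl addr0; congr (_ * _).
  by apply: eq_bigr => i _; rewrite -addrA nat1r.
rewrite /gauss_product mulrA E powRD ?n0' ?implybT// powRr1 ?ler0n// -natr1.
by field; rewrite n0' px f0.
Qed.

(** With y = n + 2, the quotient of consecutive terms is
(1 + x/y) (1 - 1/y)^x <= exp(x/y) exp(- x/y) = 1. Indices start at 1 because
0^x is a conventional value. *)
Lemma gauss_product_nincr x n : 0 <= x -> gauss_product x n.+2 <= gauss_product x n.+1.
Proof.
move=> x0; rewrite /gauss_product big_ord_recr /= factS natrM.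
set y : R := n.+2%:R; have y0 : 0 < y by [].
have -> : n.+1%:R = y - 1 by rewrite /y -[n.+2%:R]natr1 addrK.
have y1 : 0 < y - 1 by rewrite /y -[n.+2%:R]natr1 addrK.
have f0 : 0 < (n.+1)`!%:R :> R by rewrite ltr0n fact_gt0.
have P0 : 0 <= \prod_(i < n.+2) (x + i%:R) by apply: prodr_ge0 => i _; rewrite addr_ge0.
have p1 : 0 < y `^ x by exact: powR_gt0.
have p2 : 0 < (y - 1) `^ x by exact: powR_gt0.
have key : (x + y) * (y - 1) `^ x <= y * y `^ x.
  have -> : x + y = y * (1 + x / y) by field; exact: lt0r_neq0.
  rewrite -mulrA ler_pM2l//.
  apply: (@le_trans _ _ (expR (x / y) * (y - 1) `^ x)).
    by rewrite ler_pM2r// expR_ge1Dx.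
  rewrite /powR !gt_eqF// -expRD ler_expR -mulrDr ler_wpM2l//.
  have : ln ((y - 1) / y) <= - y^-1.
    have -> : (y - 1) / y = 1 + - y^-1 by field; exact: lt0r_neq0.
    by apply: le_ln1Dx; rewrite ltrN2 invf_lt1// -subr_gt0.
  rewrite ln_div ?posrE// lerBlDr => h.
  by rewrite [leLHS]addrC -lerBrDr [leRHS]addrC.
set P := \prod_(_ < _) _ in P0 *.
rewrite ler_pdivrMr ?mulr_gt0// mulrAC ler_pdivlMr ?mulr_gt0//.
rewrite -!mulrA ler_wpM2l// !mulrA [_ * _`!%:R]mulrC -!mulrA.
by rewrite mulrCA ler_pM2l.
Qed.

(** Monotone convergence for x >= 0; a negative x is brought there by finitely many
unit shifts, each of which preserves convergence by [gauss_product_shift]. *)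
Lemma is_cvg_gauss_product x : cvgn (gauss_product x).
Proof.
have [n] : exists n : nat, 0 <= x + n%:R.
  exists (Num.truncn `|x|).+1; have := truncnS_gt `|x|; have := ler_norm (- x).
  by rewrite normrN; lra.
elim: n x => [|n IHn] x xn.
  rewrite addr0 in xn.
  suff /cvg_ex[l] : cvgn (fun n => gauss_product x n.+1).
    by rewrite (cvg_shiftS (gauss_product x)) => xl; apply/cvg_ex; exists l.
  apply: nonincreasing_is_cvgn.
    by apply/nonincreasing_seqP => n; exact: gauss_product_nincr.
  exists 0 => _ [n _ <-]; apply: divr_ge0; last by rewrite mulr_ge0 ?powR_ge0.
  by apply: prodr_ge0 => i _; rewrite addr_ge0.
have /IHn/cvg_ex[l xl] : 0 <= x + 1 + n%:R by rewrite -addrA nat1r.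
have c1 : (1 + (x + 1) * n%:R^-1) @[n --> \oo] --> (1 : R).
  rewrite -[X in _ --> X]addr0; apply: cvgD; first exact: cvg_cst.
  rewrite -(mulr0 (x + 1)); apply: cvgMl_tmp; exact: cvg_invn.
have c2 : (1 + (x + 1) * n%:R^-1)^-1 @[n --> \oo] --> (1^-1 : R).
  by apply: cvgV => //; exact: oner_neq0.
have c3 : (x * gauss_product (x + 1) n * (1 + (x + 1) * n%:R^-1)^-1) @[n --> \oo]
    --> (x * l * 1^-1 : R).
  by apply: cvgM => //; exact: cvgMl_tmp.
apply/cvg_ex; exists (x * l * 1^-1).
apply: (cvg_trans _ c3); apply: near_eq_cvg; near=> m => /=.
have m0 : (0 < m)%N by near: m; exact: nbhs_infty_gt.
rewrite -gauss_product_shift// mulfK//.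
near: m; apply: (cvgr_neq0 _ c1); exact: oner_neq0.
Unshelve. all: by end_near. Qed.

Lemma cvg_gauss_product x : gauss_product x @ \oo --> rGamma x.
Proof. exact: is_cvg_gauss_product. Qed.

Lemma rGamma_shift x : rGamma x = x * rGamma (x + 1).
Proof.
have c1 : (1 + (x + 1) * n%:R^-1) @[n --> \oo] --> (1 : R).
  rewrite -[X in _ --> X]addr0; apply: cvgD; first exact: cvg_cst.
  rewrite -(mulr0 (x + 1)); apply: cvgMl_tmp; exact: cvg_invn.
have c2 : (gauss_product x n * (1 + (x + 1) * n%:R^-1)) @[n --> \oo]
    --> (rGamma x : R).
  by rewrite -[X in _ --> X]mulr1; apply: cvgM => //; exact: cvg_gauss_product.
have c3 : (x * gauss_product (x + 1) n) @[n --> \oo] --> (x * rGamma (x + 1) : R).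
  by apply: cvgMl_tmp; exact: cvg_gauss_product.
apply: (cvg_unique _ c2) => //.
apply: (cvg_trans _ c3); apply: near_eq_cvg; near=> m => /=.
by rewrite gauss_product_shift//; near: m; exact: nbhs_infty_gt.
Unshelve. all: by end_near. Qed.

Lemma prod_duplication x n : \prod_(i < n) ((x + i%:R) * (x + 1 / 2 + i%:R)) =
  (\prod_(i < n.*2) (2 * x + i%:R)) / 4 ^+ n.
Proof.
elim: n => [|n IHn]; first by rewrite !big_ord0 divr1.
rewrite doubleS !big_ord_recr /= IHn exprS -[n.*2.+1%:R]natr1 -addnn natrD.
by field; apply: expf_neq0.
Qed.

(** Interleaving the factors x + i and x + 1/2 + i gives those of 2x; the remaining
factorials and powers combine into a Wallis integral. *)
Lemma gauss_product_duplication x n : (0 < n)%N ->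
  gauss_product x n * gauss_product (x + 1 / 2) n =
  gauss_product (2 * x) n.*2.+1 * ((2 + n%:R^-1) `^ (2 * x)
    / (4 * Num.sqrt (n%:R * wallis n.*2.+1 ^+ 2))).
Proof.
move=> n0; have n0' : 0 < n%:R :> R by rewrite ltr0n.
rewrite sqrtrM// sqrtr_sqr ger0_norm ?ltW ?wallis_gt0// wallis_odd.
rewrite /gauss_product mulrACA -big_split /= prod_duplication -doubleS.
have -> : n.*2.+1%:R = n%:R * (2 + n%:R^-1) :> R.
  rewrite -natr1 -addnn natrD; field; exact: lt0r_neq0.
rewrite powRM ?ltW// powRD ?(gt_eqF n0') ?implybT// div1r powR12_sqrt//.
have -> : n%:R `^ (2 * x) = n%:R `^ x * n%:R `^ x :> R.
  by rewrite -powRD ?(gt_eqF n0') ?implybT// mulr_natl mulr2n.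
have -> : (4 ^ n * n`! ^ 2)%:R = 4 ^+ n * n`!%:R ^+ 2 :> R by rewrite natrM !natrX.
have p1 : 0 < (2 + n%:R^-1) `^ (2 * x) :> R.
  by apply: powR_gt0; rewrite addr_gt0// invr_gt0.
have p2 : 0 < n%:R `^ x :> R by exact: powR_gt0.
have s0 : 0 < Num.sqrt n%:R :> R by rewrite sqrtr_gt0.
have f0 m : 0 < m`!%:R :> R by rewrite ltr0n fact_gt0.
rewrite exprS; field.
by rewrite !(gt_eqF (f0 _)) !(gt_eqF p1) !(gt_eqF p2) !(gt_eqF s0) expf_neq0.
Qed.

Lemma cvg_powR (T : Type) (F : set_system T) {FF : Filter F} (f : T -> R) (y p : R) :
  0 < y -> f @ F --> y -> (f t `^ p) @[t --> F] --> y `^ p.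
Proof.
move=> y0 fy; apply: (@continuous_cvg _ _ _ _ _ f (fun a : R => a `^ p) y) => //.
apply/differentiable_continuous/derivable1_diffP; apply: derivable_powR.
by rewrite in_itv/= y0.
Qed.

Lemma rGamma_duplication x : rGamma x * rGamma (x + 1 / 2) =
  2 `^ (2 * x) / (2 * Num.sqrt pi) * rGamma (2 * x).
Proof.
have c1 : (gauss_product x n * gauss_product (x + 1 / 2) n) @[n --> \oo]
    --> (rGamma x * rGamma (x + 1 / 2) : R).
  by apply: cvgM; exact: cvg_gauss_product.
have c2 : gauss_product (2 * x) n.*2.+1 @[n --> \oo] --> (rGamma (2 * x) : R).
  apply: (@cvg_comp _ _ _ (fun n => n.*2.+1) _ _ \oo _ _ (cvg_gauss_product (2 * x))).
  move=> A [m _ mA]; exists m => // n /= mn; apply: mA => /=.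
  by rewrite -addnn; lia.
have c3 : (2 + n%:R^-1) `^ (2 * x) @[n --> \oo] --> (2 `^ (2 * x) : R).
  apply: cvg_powR => //; rewrite -[X in _ --> X]addr0.
  by apply: cvgD; [exact: cvg_cst | exact: cvg_invn].
have c4 : Num.sqrt (n%:R * wallis n.*2.+1 ^+ 2) @[n --> \oo]
    --> (Num.sqrt (pi / 4) : R).
  by apply: continuous_cvg; [exact: sqrt_continuous | exact: cvg_wallis].
have spi : Num.sqrt (pi / 4) = Num.sqrt pi / 2 :> R.
  rewrite sqrtrM ?pi_ge0// sqrtrV// -[4](_ : 2 ^+ 2 = _) ?sqrtr_sqr ?ger0_norm//.
  by rewrite -natrX.
have sp0 : Num.sqrt pi != 0 :> R by rewrite gt_eqF// sqrtr_gt0 pi_gt0.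
have c5 : (gauss_product (2 * x) n.*2.+1 * ((2 + n%:R^-1) `^ (2 * x)
      / (4 * Num.sqrt (n%:R * wallis n.*2.+1 ^+ 2)))) @[n --> \oo]
    --> (rGamma (2 * x) * (2 `^ (2 * x) / (4 * Num.sqrt (pi / 4))) : R).
  apply: cvgM => //; apply: cvgM => //; apply: cvgV; last exact: cvgMl_tmp.
  by rewrite spi !mulf_neq0.
transitivity (rGamma (2 * x) * (2 `^ (2 * x) / (4 * Num.sqrt (pi / 4))) : R);
  last by rewrite spi; field.
apply: (cvg_unique _ c1) => //.
apply: (cvg_trans _ c5); apply: near_eq_cvg; near=> n.
by rewrite gauss_product_duplication//; near: n; exact: nbhs_infty_gt.
Unshelve. all: by end_near. Qed.
End ReciprocalGamma.

(** * Recurrences for Laguerre polynomials *)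

(** Reduces an equation to a multiple of a known one, leaving a polynomial identity
for [ring]. *)
Lemma eq_from_multiple (S : comPzRingType) (c x y u v : S) :
  u = v -> x - y = c * (u - v) -> x = y.
Proof. by move=> ->; rewrite subrr mulr0 => /subr0_eq. Qed.

Section LaguerrePolynomials.
Context {R : realType}.
Variables (tau a : R).
Local Notation coef := (laguerre_coef a).
Implicit Types j k : nat.

Lemma laguerre_coefSl j k : (k <= j)%N ->
  (j.+1 - k)%:R * coef j.+1 k = (j.+1%:R + a) * coef j k.
Proof.
move=> kj; rewrite /laguerre_coef big_nat_recr //= subSn// factS natrM.
have f0 m : m`!%:R != 0 :> R by rewrite pnatr_eq0 -lt0n fact_gt0.
by field; rewrite !f0/= nat1r pnatr_eq0.
Qed.

Lemma laguerre_coefSS j k : (k <= j)%N ->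
  k.+1%:R * (k.+1%:R + a) * coef j.+1 k.+1 = (j.+1%:R + a) * coef j k.
Proof.
move=> kj; rewrite /laguerre_coef subSS factS natrM.
have E : (a + k.+1%:R) * \prod_(k.+1 <= i < j.+1) (a + i.+1%:R) =
    (\prod_(k <= i < j) (a + i.+1%:R)) * (a + j.+1%:R).
  by rewrite -big_nat_recr //= [RHS]big_ltn.
have f0 m : m`!%:R != 0 :> R by rewrite pnatr_eq0 -lt0n fact_gt0.
rewrite [X in X = _](_ : _ = (a + k.+1%:R)
    * \prod_(k.+1 <= i < j.+1) (a + i.+1%:R) / ((j - k)`!%:R * k`!%:R)).
  by rewrite E; field; rewrite !f0.
by field; rewrite !f0/= nat1r pnatr_eq0.
Qed.

Lemma laguerre_coef_diag j : j.+1%:R * coef j.+1 j.+1 = coef j j.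
Proof.
rewrite /laguerre_coef !big_geq// !subnn factS natrM.
have f0 m : m`!%:R != 0 :> R by rewrite pnatr_eq0 -lt0n fact_gt0.
by field; rewrite !f0/= nat1r pnatr_eq0.
Qed.

Lemma laguerre_coefSr j k : (k < j)%N ->
  k.+1%:R * (k.+1%:R + a) * coef j k.+1 = (j - k)%:R * coef j k.
Proof.
case: j => // j; rewrite ltnS => kj.
by rewrite laguerre_coefSS// laguerre_coefSl.
Qed.

Lemma laguerre_coef_raise j k : (k < j)%N ->
  j.+1%:R * coef j.+1 k.+1 = (j.+1%:R + a + k.+1%:R) * coef j k.+1 + coef j k.
Proof.
move=> kj; have jk0 : (j - k)%:R != 0 :> R by rewrite pnatr_eq0 subn_eq0 -ltnNge.
apply: (mulfI jk0).
have e1 := laguerre_coefSl _ _ kj; rewrite subSS in e1.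
have e2 := laguerre_coefSr _ _ kj.
rewrite mulrDr -e2 mulrCA e1 natrB ?(ltnW kj)// -[j.+1%:R]natr1 -[k.+1%:R]natr1.
ring.
Qed.

(** The real polynomial in z whose value is tau^j L_j^(a)(z/tau). *)
Definition laguerre_poly j : {poly R} :=
  \poly_(k < j.+1) ((-1) ^+ k * coef j k * tau ^+ (j - k)).

(** Index j - 1, with value 0 at j = 0, so that recurrences hold for all j. *)
Definition laguerre_poly_pred j : {poly R} :=
  if j is j'.+1 then laguerre_poly j' else 0.

Lemma laguerre_poly0 : laguerre_poly 0 = 1.
Proof.
apply/polyP => -[|k]; rewrite coef_poly coef1//= /laguerre_coef big_geq//.
by rewrite expr0 !mul1r invr1 !mulr1.
Qed.

(** The classical x L_j' = j L_j - (j + a) L_{j-1}. *)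
Lemma laguerre_poly_euler j :
  'X * (laguerre_poly j)^`() =
  j%:R *: laguerre_poly j - ((j%:R + a) * tau) *: laguerre_poly_pred j.
Proof.
case: j => [|j].
  by rewrite laguerre_poly0 derivC mulr0 scale0r scaler0 subrr.
apply/polyP => k; rewrite coefXM coefB !coefZ coef_deriv !coef_poly.
case: k => [|k] /=.
  have := laguerre_coefSl _ _ (leq0n j); rewrite !subn0 [tau ^+ j.+1]exprS.
  move=> e; apply: (eq_from_multiple _ (- tau * tau ^+ j) _ _ _ _ e).
  by rewrite expr0; ring.
rewrite !ltnS -[LHS]mulr_natl; case: (ltngtP k j) => [kj|kj|->].
- have := laguerre_coefSl _ _ (kj : (k.+1 <= j)%N).
  rewrite subSS natrB ?(ltnW kj)// -(subnSK kj) [tau ^+ _.+1]exprS.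
  move=> e; apply: (eq_from_multiple _
    (- (-1) ^+ k.+1 * tau * tau ^+ (j - k.+1)) _ _ _ _ e).
  by rewrite -[j.+1%:R]natr1 -[k.+1%:R]natr1; ring.
- by rewrite !mulr0 subr0.
- by rewrite mulr0 subr0.
Qed.

(** The classical x L_j'' + (a + 1) L_j' = - (j + a) L_{j-1}: Laguerre's equation
combined with [laguerre_poly_euler]. Both sides scale alike under x = z/tau, so
tau does not appear as a factor. *)
Lemma laguerre_poly_lower j :
  'X * (laguerre_poly j)^`()^`() + (a + 1) *: (laguerre_poly j)^`() =
  - (j%:R + a) *: laguerre_poly_pred j.
Proof.
case: j => [|j].
  by rewrite laguerre_poly0 derivC deriv0 mulr0 !scaler0 addr0.
apply/polyP => k; rewrite coefD coefXM !coefZ !coef_deriv /laguerre_poly_pred.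
have -> : (if k == 0%N then 0 else (laguerre_poly j.+1)`_k.-1.+2 *+ k.-1.+2 *+ k.-1.+1)
    = k%:R * k.+1%:R * (laguerre_poly j.+1)`_k.+1.
  case: k => [|k] /=; first by rewrite !mul0r.
  by rewrite -mulrnA -[LHS]mulr_natl natrM; ring.
rewrite -[(laguerre_poly _)`__ *+ _]mulr_natl !coef_poly !ltnS; case: leqP => [kj|_];
  last by rewrite !mulr0 addr0.
have e := laguerre_coefSS _ _ kj.
rewrite subSS; apply: (eq_from_multiple _ (- (-1) ^+ k * tau ^+ (j - k)) _ _ _ _ e).
by rewrite exprS -[j.+1%:R]natr1 -[k.+1%:R]natr1; ring.
Qed.

(** The classical (j + 1) L_{j+1} = (j + 1 + a) L_j + x L_j' - x L_j; together with
[laguerre_poly_euler] it yields the three-term recurrence. *)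
Lemma laguerre_poly_raise j : j.+1%:R *: laguerre_poly j.+1 =
  ((j.+1%:R + a) * tau) *: laguerre_poly j
  + tau *: ('X * (laguerre_poly j)^`()) - 'X * laguerre_poly j.
Proof.
apply/polyP => k; rewrite coefB coefD !coefZ !coefXM !coef_deriv !coef_poly.
case: k => [|k] /=.
  have := laguerre_coefSl _ _ (leq0n j); rewrite !subn0 [tau ^+ j.+1]exprS.
  move=> e; apply: (eq_from_multiple _ (tau * tau ^+ j) _ _ _ _ e).
  by rewrite expr0; ring.
rewrite !ltnS subSS -[_ *+ k.+1]mulr_natl; case: (ltngtP k j) => [kj|kj|->].
- have e := laguerre_coef_raise _ _ kj.
  rewrite -(subnSK kj) [tau ^+ _.+1]exprS.
  apply: (eq_from_multiple _ ((-1) ^+ k.+1 * tau * tau ^+ (j - k.+1)) _ _ _ _ e).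
  rewrite exprS -[j.+1%:R]natr1 -[k.+1%:R]natr1; ring.
- by rewrite !mulr0 !addr0 subr0.
- have e := laguerre_coef_diag j.
  rewrite subnn !expr0 !mulr0 !add0r.
  apply: (eq_from_multiple _ ((-1) ^+ j.+1) _ _ _ _ e).
  rewrite exprS; ring.
Qed.
End LaguerrePolynomials.

(** * The second-order operator and the complex kernel *)

Section ComplexKernel.
Context {R : realType}.
Implicit Types (tau a nu : R) (z w : R[i]).

(** Stated over any field with a norm, since the polynomials here have complex
arguments. *)
Lemma derivable_horner_num (F : numFieldType) (p : {poly F}) x :
  derivable (horner p : F -> F^o) x 1.
Proof.
elim/poly_ind: p => [|p c IHp].
  have -> : (horner 0 : F -> F^o) = cst 0 by apply/funext => y; rewrite horner0.
  exact: derivable_cst.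
have -> : (horner (p * 'X + c%:P) : F -> F^o) = (horner p : F -> F^o) * id + cst c.
  by apply/funext => y; rewrite !fctE !hornerE.
by apply: derivableD; [apply: derivableM|exact: derivable_cst].
Qed.

Lemma derive1_horner (F : numFieldType) (p : {poly F}) :
  derive1 (horner p : F -> F^o) = horner p^`().
Proof.
apply/funext => x; rewrite derive1E; elim/poly_ind: p => [|p c IHp].
  have -> : (horner 0 : F -> F^o) = cst 0 by apply/funext => y; rewrite horner0.
  by rewrite derive_cst deriv0 horner0.
have -> : (horner (p * 'X + c%:P) : F -> F^o) = (horner p : F -> F^o) * id + cst c.
  by apply/funext => y; rewrite !fctE !hornerE.
have dp := derivable_horner_num _ p x.
rewrite deriveD; [|by apply: derivableM|exact: derivable_cst].
rewrite derive_cst addr0 deriveM// IHp derive_id /GRing.scale /=.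
by rewrite derivD derivM derivX derivC !hornerE; ring.
Qed.

Definition laguerre_cpoly tau a j : {poly R[i]} :=
  map_poly (real_complex R) (laguerre_poly tau a j).
Definition laguerre_cpoly_pred tau a j : {poly R[i]} :=
  if j is j'.+1 then laguerre_cpoly tau a j' else 0.

Lemma laguerre_cpoly_predE tau a j :
  laguerre_cpoly_pred tau a j = map_poly (real_complex R) (laguerre_poly_pred tau a j).
Proof. by case: j => //=; rewrite rmorph0. Qed.

Lemma hlaguerre_horner tau a j z : hlaguerre tau a j z = (laguerre_cpoly tau a j).[z].
Proof.
rewrite (@horner_coef_wide _ j.+1); last first.
  by rewrite size_map_poly; exact: size_poly.
apply: eq_bigr => k _; rewrite coef_map coef_poly ltn_ord /=.
move: (laguerre_coef a j k) => c; rewrite !rmorphM /= !rmorphXn /= rmorphN1.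
by rewrite -[- z]mulN1r exprMn; ring.
Qed.

(** The operator D of the introduction, with n standing for the Laguerre parameter,
applied to p and evaluated at z. *)
Definition laguerre_op (t n z : R[i]) (p : {poly R[i]}) : R[i] :=
  (1 - t ^+ 2) * z * p^`()^`().[z]
  + ((n + 1) * (1 - t ^+ 2) + 2 * t * z) * p^`().[z]
  + (t * (n + 1) - z) * p.[z].

Lemma laguerre_opD t n z p q : laguerre_op t n z (p + q) =
  laguerre_op t n z p + laguerre_op t n z q.
Proof. by rewrite /laguerre_op !derivD !hornerD; ring. Qed.

Lemma laguerre_opZ t n z c p : laguerre_op t n z (c *: p) = c * laguerre_op t n z p.
Proof. by rewrite /laguerre_op !derivZ !hornerZ; ring. Qed.

Lemma laguerre_opB t n z p q : laguerre_op t n z (p - q) =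
  laguerre_op t n z p - laguerre_op t n z q.
Proof. by rewrite -scaleN1r laguerre_opD laguerre_opZ mulN1r. Qed.

Lemma laguerre_op0 t n z : laguerre_op t n z 0 = 0.
Proof. by rewrite /laguerre_op !deriv0 !horner0; ring. Qed.

Lemma laguerre_cpoly_euler tau a j z : z * (laguerre_cpoly tau a j)^`().[z] =
  j%:R * (laguerre_cpoly tau a j).[z]
  - (j%:R + a%:C) * tau%:C * (laguerre_cpoly_pred tau a j).[z].
Proof.
have /(congr1 (fun p : {poly R} => (map_poly (real_complex R) p).[z])) :=
  laguerre_poly_euler tau a j.
rewrite rmorphM rmorphB /= map_polyX !map_polyZ deriv_map
  -laguerre_cpoly_predE !hornerE.
by rewrite !rmorphM rmorphD !rmorph_nat.
Qed.

Lemma laguerre_cpoly_lower tau a j z :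
  z * (laguerre_cpoly tau a j)^`()^`().[z]
    + (a%:C + 1) * (laguerre_cpoly tau a j)^`().[z] =
  - (j%:R + a%:C) * (laguerre_cpoly_pred tau a j).[z].
Proof.
have /(congr1 (fun p : {poly R} => (map_poly (real_complex R) p).[z])) :=
  laguerre_poly_lower tau a j.
rewrite rmorphD rmorphM /= map_polyX !map_polyZ !deriv_map
  -laguerre_cpoly_predE !hornerE.
by rewrite rmorphN !rmorphD !rmorph_nat rmorph1.
Qed.

Lemma laguerre_cpoly_three_term tau a j z : z * (laguerre_cpoly tau a j).[z] =
  - j.+1%:R * (laguerre_cpoly tau a j.+1).[z]
  + (2 * j%:R + a%:C + 1) * tau%:C * (laguerre_cpoly tau a j).[z]
  - (j%:R + a%:C) * tau%:C ^+ 2 * (laguerre_cpoly_pred tau a j).[z].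
Proof.
have /(congr1 (fun p : {poly R} => (map_poly (real_complex R) p).[z])) :=
  laguerre_poly_raise tau a j.
rewrite rmorphB rmorphD /= !map_polyZ !rmorphM /= map_polyX -deriv_map
  !(hornerD, hornerN, hornerZ, hornerM, hornerX).
rewrite -/(laguerre_cpoly tau a j) -/(laguerre_cpoly tau a j.+1) laguerre_cpoly_euler
  rmorphD !rmorph_nat => e.
apply: (eq_from_multiple _ 1 _ _ _ _ e).
by rewrite -[j.+1%:R]natr1; ring.
Qed.

(** D equals (1 - t^2) (z d^2 + (a + 1) d) + 2 t (z d) + t (a + 1) - z, and each of
these pieces acts on the Laguerre polynomials by a recurrence. The terms in the
polynomial of index j itself cancel. *)
Lemma laguerre_op_cpoly tau a j z : laguerre_op tau%:C a%:C z (laguerre_cpoly tau a j) =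
  j.+1%:R * (laguerre_cpoly tau a j.+1).[z]
  - (j%:R + a%:C) * (laguerre_cpoly_pred tau a j).[z].
Proof.
have e1 := laguerre_cpoly_lower tau a j z; have e2 := laguerre_cpoly_euler tau a j z.
have e3 := laguerre_cpoly_three_term tau a j z.
have -> : laguerre_op tau%:C a%:C z (laguerre_cpoly tau a j) =
  (1 - tau%:C ^+ 2) * (z * (laguerre_cpoly tau a j)^`()^`().[z]
    + (a%:C + 1) * (laguerre_cpoly tau a j)^`().[z])
  + 2 * tau%:C * (z * (laguerre_cpoly tau a j)^`().[z])
  + tau%:C * (a%:C + 1) * (laguerre_cpoly tau a j).[z]
  - z * (laguerre_cpoly tau a j).[z].
  by rewrite /laguerre_op; ring.
by rewrite e1 e2 e3; ring.
Qed.


Definition kernel_coef a (j : nat) : R := j`!%:R * rGamma (j%:R + a + 1).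
(** The coefficient of the boundary terms in the telescoping sum. *)
Definition kernel_edge a (j : nat) : R := j`!%:R * rGamma (j%:R + a).

Lemma kernel_coefS a j : kernel_coef a j * j.+1%:R = kernel_edge a j.+1.
Proof.
by rewrite /kernel_coef /kernel_edge factS natrM -natr1 addrAC; ring.
Qed.

Lemma kernel_coefD a j : kernel_coef a j * (j%:R + a) = kernel_edge a j.
Proof. by rewrite /kernel_coef /kernel_edge [in RHS]rGamma_shift; ring. Qed.

Definition cKernel_poly tau nu N w : {poly R[i]} :=
  \sum_(j < N) ((kernel_coef nu j)%:C * (laguerre_cpoly tau nu j).[w])
    *: laguerre_cpoly tau nu j.

Lemma cKernel_horner tau nu N w :
  (fun u => cKernel tau nu N u w) = horner (cKernel_poly tau nu N w).
Proof.
apply/funext => u; rewrite horner_sum; apply: eq_bigr => j _.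
by rewrite !hlaguerre_horner hornerZ -mulrA [X in _ = _ * X]mulrC.
Qed.

(** The first identity multiplied by 1 - t^2, which covers t = 1 as well. At N = 0
both sides vanish, the boundary term because of the convention on the index
-1. *)
Lemma cKernel_poly_identity tau nu N z w (t := tau%:C) :
  (1 - t ^+ 2) * (laguerre_op t nu%:C z (cKernel_poly tau nu N w)
    + z * (cKernel_poly tau nu N w).[z])
    + (t ^+ 2 * z - w) * (cKernel_poly tau nu N w).[z] =
  (kernel_edge nu N)%:C
    * ((laguerre_cpoly_pred tau nu N).[z] * (laguerre_cpoly tau nu N).[w]
    - t ^+ 2 * ((laguerre_cpoly tau nu N).[z] * (laguerre_cpoly_pred tau nu N).[w])).
Proof.
elim: N => [|N IHN].
  by rewrite /cKernel_poly big_ord0 laguerre_op0 !horner0; ring.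
rewrite {1 2 3}/cKernel_poly !big_ord_recr /= -!/(cKernel_poly _ _ _ _).
rewrite laguerre_opD laguerre_opZ laguerre_op_cpoly hornerD hornerZ -/t.
set P := cKernel_poly _ _ _ _ in IHN *.
have ez := laguerre_cpoly_three_term tau nu N z.
have ew := laguerre_cpoly_three_term tau nu N w.
rewrite -/t in ez ew.
rewrite -kernel_coefS; rewrite -kernel_coefD in IHN.
move: (kernel_coef nu N) IHN => c IHN.
rewrite !rmorphM rmorphD !rmorph_nat /= in IHN *.
move: (laguerre_cpoly tau nu N.+1).[z] (laguerre_cpoly tau nu N.+1).[w] ez ew
  => H1z H1w ez ew.
move: (laguerre_cpoly tau nu N).[z] (laguerre_cpoly tau nu N).[w] IHN ez ew
  => Hz Hw IHN ez ew.
set H0z := (laguerre_cpoly_pred tau nu N).[z] in IHN ez *.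
set H0w := (laguerre_cpoly_pred tau nu N).[w] in IHN ew *.
(* The three-term recurrences trade the factors z and w for neighbouring indices. *)
have e := f_equal2 +%R IHN
  (f_equal2 (fun x y => c%:C * (Hw * x - Hz * y)) ez ew).
apply: (eq_from_multiple _ 1 _ _ _ _ e).
by rewrite -[N.+1%:R]natr1; ring.
Qed.
End ComplexKernel.

(** * The symplectic kernel *)

Section SymplecticKernel.
Context {R : realType}.
Implicit Types (tau nu : R) (z w : R[i]) (j k N : nat).

(** The weights of the odd and of the even Laguerre polynomials in the prekernel. *)
Definition odd_coef nu k : R :=
  (dfact (2 * k))%:R / 2 ^+ k * rGamma (k%:R + nu + 3 / 2).
Definition even_coef nu j : R :=
  (dfact (2 * j - 1))%:R / 2 ^+ j * rGamma (j%:R + nu + 1).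
(** The coefficients of the boundary terms when the operator is applied to the odd,
respectively the even, weighted Laguerre polynomials. *)
Definition odd_edge nu k : R := k`!%:R * rGamma (k%:R + nu + 1 / 2).
Definition even_edge nu j : R :=
  (dfact (2 * j - 1))%:R / 2 ^+ j * rGamma (j%:R + nu).
Definition pre_coef nu : R := Num.sqrt pi / 2 `^ (2 * nu + 1).

Lemma dfact_even k : dfact (2 * k) = (2 ^ k * k`!)%N.
Proof.
elim: k => // k IHk; rewrite mulnS /= -/(dfact (2 * k)) IHk factS expnS; ring.
Qed.

Lemma dfact_oddS j : dfact (2 * j.+1 - 1) = (j.*2.+1 * dfact (2 * j - 1))%N.
Proof.
case: j => // j; rewrite -!mul2n.
have -> : (2 * j.+2 - 1 = (2 * j + 1).+2)%N by lia.
have -> : (2 * j.+1 - 1 = 2 * j + 1)%N by lia.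
have -> : ((2 * j.+1).+1 = (2 * j + 1).+2)%N by lia.
by [].
Qed.

Lemma dfact_odd j : (dfact (2 * j - 1) * (2 ^ j * j`!) = (2 * j)`!)%N.
Proof.
elim: j => // j IHj; rewrite dfact_oddS mulnS !factS -IHj expnS -mul2n.
by ring.
Qed.

Lemma odd_coefE nu k : odd_coef nu k = k`!%:R * rGamma (k%:R + nu + 3 / 2).
Proof.
by rewrite /odd_coef dfact_even natrM natrX; field; rewrite expf_neq0.
Qed.

Lemma odd_coefS nu k : odd_coef nu k * (2 * k.+1)%:R = 2 * odd_edge nu k.+1.
Proof.
rewrite odd_coefE /odd_edge factS !natrM.
have -> : k.+1%:R + nu + 1 / 2 = k%:R + nu + 3 / 2 by rewrite -natr1; field.
by ring.
Qed.

Lemma odd_coefD nu k : odd_coef nu k * ((2 * k + 1)%:R + 2 * nu) = 2 * odd_edge nu k.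
Proof.
rewrite odd_coefE /odd_edge [in RHS]rGamma_shift natrD natrM.
have -> : k%:R + nu + 1 / 2 + 1 = k%:R + nu + 3 / 2 by field.
by field.
Qed.

Lemma even_coefS nu j : even_coef nu j * (2 * j).+1%:R = 2 * even_edge nu j.+1.
Proof.
rewrite /even_coef /even_edge dfact_oddS natrM exprS -mul2n.
have -> : j.+1%:R + nu = j%:R + nu + 1 by rewrite -natr1; ring.
by field; rewrite expf_neq0.
Qed.

Lemma even_coefD nu j : even_coef nu j * ((2 * j)%:R + 2 * nu) = 2 * even_edge nu j.
Proof.
rewrite /even_coef /even_edge [in RHS]rGamma_shift natrM; ring.
Qed.

(** The duplication formula at (m + x + 1)/2, in the form common to even and odd
m. *)
Lemma kernel_coef_duplication x m : 2 * (Num.sqrt pi / 2 `^ (x + 1))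
   * (rGamma ((m%:R + x + 1) / 2) * rGamma ((m%:R + x + 1) / 2 + 1 / 2)) =
  2 ^+ m * rGamma (m%:R + x + 1) :> R.
Proof.
rewrite rGamma_duplication.
have -> : 2 * ((m%:R + x + 1) / 2) = m%:R + x + 1 by field.
rewrite -addrA [2 `^ (m%:R + _)]powRD ?pnatr_eq0 ?implybT// powR_mulrn//.
have sp0 : Num.sqrt pi != 0 :> R by rewrite gt_eqF// sqrtr_gt0 pi_gt0.
have p0 : 2 `^ (x + 1) != 0 :> R by rewrite gt_eqF// powR_gt0.
by field; rewrite sp0.
Qed.

(** The diagonal terms left by the telescoping sums carry these coefficients;
duplication merges their two Gamma values, and the double factorials merge to
(2j)!. [odd_coef_even_edge] is the counterpart for the odd indices. *)
Lemma odd_edge_even_coef nu j :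
  2 * pre_coef nu * (odd_edge nu j * even_coef nu j) = kernel_coef (2 * nu) (2 * j).
Proof.
have := kernel_coef_duplication (2 * nu) (2 * j).
have -> : ((2 * j)%:R + 2 * nu + 1) / 2 = j%:R + nu + 1 / 2 by rewrite natrM; field.
have -> : j%:R + nu + 1 / 2 + 1 / 2 = j%:R + nu + 1 by field.
rewrite /pre_coef /odd_edge /even_coef /kernel_coef -dfact_odd !natrM natrX exprM => e.
have f0 : 2 ^+ j != 0 :> R by rewrite expf_neq0.
apply: (eq_from_multiple _ (j`!%:R * (dfact (2 * j - 1))%:R / 2 ^+ j) _ _ _ _ e).
have -> : (2 ^+ 2) ^+ j = 2 ^+ j * 2 ^+ j :> R by rewrite -exprM mulnC exprM.
have p0 : 2 `^ (2 * nu + 1) != 0 :> R by rewrite gt_eqF// powR_gt0.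
by field; rewrite p0.
Qed.

Lemma odd_coef_even_edge nu k :
  2 * pre_coef nu * (odd_coef nu k * even_edge nu k.+1) =
  kernel_coef (2 * nu) (2 * k + 1).
Proof.
have := kernel_coef_duplication (2 * nu) (2 * k + 1).
have -> : ((2 * k + 1)%:R + 2 * nu + 1) / 2 = k.+1%:R + nu.
  by rewrite natrD natrM -natr1; field.
have -> : k.+1%:R + nu + 1 / 2 = k%:R + nu + 3 / 2 by rewrite -natr1; field.
rewrite /pre_coef odd_coefE /even_edge /kernel_coef addn1 factS -dfact_odd dfact_oddS -mul2n.
rewrite [((2 * k).+1 * (_ * _))%:R]natrM !natrM natrX !exprS exprM => e.
have f0 : 2 ^+ k != 0 :> R by rewrite expf_neq0.
apply: (eq_from_multiple _
  (k`!%:R * ((2 * k).+1%:R * (dfact (2 * k - 1))%:R) / (2 * 2 ^+ k)) _ _ _ _ e).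
have -> : (2 ^+ 2) ^+ k = 2 ^+ k * 2 ^+ k :> R by rewrite -exprM mulnC exprM.
have p0 : 2 `^ (2 * nu + 1) != 0 :> R by rewrite gt_eqF// powR_gt0.
by field; rewrite p0.
Qed.

Definition even_sum_poly tau nu k : {poly R[i]} :=
  \sum_(j < k) (even_coef nu j)%:C *: laguerre_cpoly tau (2 * nu) (2 * j).

(** The two shifts produced by the operator are odd-indexed and cancel between
consecutive terms of the sum; only the last one survives. *)
Lemma laguerre_op_even_sum tau nu k z :
  laguerre_op tau%:C (2 * nu)%:C z (even_sum_poly tau nu k) =
  2 * (even_edge nu k)%:C * (laguerre_cpoly_pred tau (2 * nu) (2 * k)).[z].
Proof.
elim: k => [|k IHk]; first by rewrite /even_sum_poly big_ord0 laguerre_op0 horner0 mulr0.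
have -> : laguerre_cpoly_pred tau (2 * nu) (2 * k.+1)
    = laguerre_cpoly tau (2 * nu) (2 * k).+1.
  by rewrite mulnS.
rewrite /even_sum_poly big_ord_recr /= -/(even_sum_poly _ _ _)
  laguerre_opD laguerre_opZ IHk laguerre_op_cpoly.
have e1 := congr1 (real_complex R) (even_coefS nu k).
have e2 := congr1 (real_complex R) (even_coefD nu k).
move: (even_coef nu k) (even_edge nu k) (even_edge nu k.+1) e1 e2 => e b b'.
rewrite !rmorphM /= !rmorph_nat rmorphD /= rmorphM /= !rmorph_nat => e1 e2.
by rewrite mulrBr !mulrA e1 e2 addrC subrK.
Qed.

(** The double sum of the kernel, with the inner sum over even indices carried
out. *)
Definition sKernel_poly tau nu N w : {poly R[i]} :=
  (- (pre_coef nu)%:C) *: \sum_(k < N) (odd_coef nu k)%:C *: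
    ((even_sum_poly tau nu k.+1).[w] *: laguerre_cpoly tau (2 * nu) (2 * k + 1)
     - (laguerre_cpoly tau (2 * nu) (2 * k + 1)).[w] *: even_sum_poly tau nu k.+1).

Lemma preKernelE tau nu N z w : preKernel tau nu N z w =
  - (pre_coef nu)%:C * \sum_(k < N) (odd_coef nu k)%:C *
     ((laguerre_cpoly tau (2 * nu) (2 * k + 1)).[z] * (even_sum_poly tau nu k.+1).[w]).
Proof.
congr (_ * _); apply: eq_bigr => k _.
rewrite horner_sum !mulr_sumr; apply: eq_bigr => j _.
by rewrite !hlaguerre_horner hornerZ -/(odd_coef nu k) -/(even_coef nu j); ring.
Qed.

Lemma sKernel_horner tau nu N w :
  (fun u => sKernel tau nu N u w) = horner (sKernel_poly tau nu N w).
Proof.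
apply/funext => u; rewrite /sKernel !preKernelE /sKernel_poly hornerZ horner_sum.
rewrite -mulrBr -sumrB; congr (_ * _); apply: eq_bigr => k _.
by rewrite hornerZ hornerD hornerN !hornerZ; ring.
Qed.

(** Passing from N to N + 1 adds the odd polynomial of index 2N + 1 paired with the
even sum up to 2N. The operator turns the former into its two even neighbours,
which move the boundary term and give the diagonal term of index 2N; it turns
the latter into the diagonal term of index 2N + 1. *)
Lemma sKernel_poly_identity tau nu N z w :
  laguerre_op tau%:C (2 * nu)%:C z (sKernel_poly tau nu N w) =
  (cKernel_poly tau (2 * nu) (2 * N) w).[z]
   - 2 * (pre_coef nu)%:C * (odd_edge nu N)%:C * (laguerre_cpoly tau (2 * nu) (2 * N)).[z]
     * (even_sum_poly tau nu N).[w].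
Proof.
elim: N => [|N IHN].
  by rewrite /sKernel_poly /cKernel_poly /even_sum_poly
    !big_ord0 scaler0 laguerre_op0 !horner0; ring.
rewrite /sKernel_poly big_ord_recr /= scalerDr laguerre_opD -/(sKernel_poly _ _ _ _) IHN.
rewrite !laguerre_opZ laguerre_opB !laguerre_opZ laguerre_op_even_sum addn1
  laguerre_op_cpoly.
have -> : laguerre_cpoly_pred tau (2 * nu) (2 * N.+1)
    = laguerre_cpoly tau (2 * nu) (2 * N).+1.
  by rewrite mulnS.
rewrite /cKernel_poly mulnS !big_ord_recr /= -/(cKernel_poly _ _ _ _) -mulnS.
rewrite !hornerD !hornerZ.
rewrite [even_sum_poly _ _ N.+1]/even_sum_poly big_ord_recr /= -/(even_sum_poly _ _ _)
  hornerD hornerZ.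
have e1 := congr1 (real_complex R) (odd_coefS nu N).
have e2 := congr1 (real_complex R) (odd_coefD nu N).
have := odd_coef_even_edge nu N; rewrite addn1 => <-; rewrite -odd_edge_even_coef.
have eN : (2 * N.+1 = (2 * N).+2)%N by rewrite mulnS.
rewrite !eN in e1 *.
rewrite addn1 in e2.
move: (odd_coef nu N) (even_coef nu N) (odd_edge nu N) (odd_edge nu N.+1) (even_edge nu N.+1)
  (pre_coef nu) e1 e2 => A B a a' b c.
rewrite !rmorphM /= !rmorph_nat rmorphD /= rmorphM /= !rmorph_nat => e1 e2.
have E := f_equal2 (fun x y =>
  - c%:C * ((even_sum_poly tau nu N).[w]
    + B%:C * (laguerre_cpoly tau (2 * nu) (2 * N)).[w])
  * (x * (laguerre_cpoly tau (2 * nu) (2 * N).+2).[z]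
    - y * (laguerre_cpoly tau (2 * nu) (2 * N)).[z])) e1 e2.
apply: (eq_from_multiple _ 1 _ _ _ _ E).
ring.
Qed.
End SymplecticKernel.


Theorem theorem1p1 (R : realType) (tau nu : R) (N : nat) (z w : R[i])
    (tau_ge0 : 0 <= tau) (tau_le1 : tau <= 1) (N_gt0 : (0 < N)%N) :
  let t : R[i] := tau%:C in
  let n : R[i] := nu%:C in
  (* (i), for tau < 1 *)
  (tau < 1 ->
    let K : R[i] -> R[i] := fun u => cKernel tau nu N u w in
    (1 - t ^+ 2) * z * cderive (cderive K) z
      + ((1 - t ^+ 2) * (n + 1) + 2 * t * z) * cderive K z
      + ((t ^+ 2 * z - w) / (1 - t ^+ 2) + (n + 1) * t) * K z
    = (N`!%:R * rGamma (N%:R + nu))%:C / (1 - t ^+ 2)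
      * (hlaguerre tau nu (N - 1) z * hlaguerre tau nu N w
         - t ^+ 2 * (hlaguerre tau nu N z * hlaguerre tau nu (N - 1) w)))
  /\
  (* (i), for tau = 1: both sides multiplied by 1 - tau^2 *)
  (tau = 1 ->
    let K : R[i] -> R[i] := fun u => cKernel tau nu N u w in
    (1 - t ^+ 2) * ((1 - t ^+ 2) * z * cderive (cderive K) z
      + ((1 - t ^+ 2) * (n + 1) + 2 * t * z) * cderive K z
      + (n + 1) * t * K z)
      + (t ^+ 2 * z - w) * K z
    = (N`!%:R * rGamma (N%:R + nu))%:C
      * (hlaguerre tau nu (N - 1) z * hlaguerre tau nu N w
         - t ^+ 2 * (hlaguerre tau nu N z * hlaguerre tau nu (N - 1) w)))
  /\
  (* (ii) *)
  (let kappa : R[i] -> R[i] := fun u => sKernel tau nu N u w in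
    (1 - t ^+ 2) * z * cderive (cderive kappa) z
      + ((2 * n + 1) * (1 - t ^+ 2) + 2 * t * z) * cderive kappa z
      + (t * (2 * n + 1) - z) * kappa z
    = cKernel tau (2 * nu) (2 * N) z w
      - (Num.sqrt pi * N`!%:R / 2 `^ (2 * nu)
           * rGamma (N%:R + nu + 1 / 2))%:C
        * hlaguerre tau (2 * nu) (2 * N) z
        * \sum_(j < N) ((dfact (2 * j - 1))%:R / 2 ^+ j
                          * rGamma (j%:R + nu + 1))%:C
                       * hlaguerre tau (2 * nu) (2 * j) w).
Proof.
move=> t n.
have cderiveE (p : {poly R[i]}) : cderive (horner p) = horner p^`()
  by exact: derive1_horner.
have predN : laguerre_cpoly_pred tau nu N = laguerre_cpoly tau nu (N - 1)
  by case: N N_gt0 => // m; rewrite subn1.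
have := cKernel_poly_identity tau nu N z w;
  rewrite predN /kernel_edge /laguerre_op -/t -/n => keyK.
have KzE a M : cKernel tau a M z w = (cKernel_poly tau a M w).[z].
  exact: (congr1 (fun f : R[i] -> R[i] => f z) (cKernel_horner tau a M w)).
split; last split.
- move=> tau1.
  have t1 : 1 - t ^+ 2 != 0.
    rewrite -rmorphXn -(rmorph1 (real_complex R)) -rmorphB fmorph_eq0 subr_eq0.
    by rewrite eq_sym lt_eqF// expr_lt1.
  rewrite cKernel_horner KzE !cderiveE !hlaguerre_horner.
  apply: (mulfI t1); rewrite [RHS]mulrA [_ * (_ / _)]mulrC divfK// -keyK.
  by field.
- move=> _; rewrite cKernel_horner KzE !cderiveE !hlaguerre_horner -keyK; ring.
- rewrite /= sKernel_horner KzE.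
  have kzE : sKernel tau nu N z w = (sKernel_poly tau nu N w).[z].
    exact: (congr1 (fun f : R[i] -> R[i] => f z) (sKernel_horner tau nu N w)).
  have S_E : (even_sum_poly tau nu N).[w] =
      \sum_(j < N) (even_coef nu j)%:C * hlaguerre tau (2 * nu) (2 * j) w.
    by rewrite horner_sum; apply: eq_bigr => j _; rewrite hornerZ hlaguerre_horner.
  (* The factor 2 of both telescoping sums turns 2^(2 nu + 1) into 2^(2 nu). *)
  have c_E : Num.sqrt pi * N`!%:R / 2 `^ (2 * nu) * rGamma (N%:R + nu + 1 / 2) =
     2 * pre_coef nu * odd_edge nu N.
    rewrite /pre_coef /odd_edge powRD ?pnatr_eq0 ?implybT// powRr1//.
    by field; rewrite gt_eqF// powR_gt0.
  have n_E : 2 * n = (2 * nu)%:C by rewrite rmorphM /= rmorph_nat.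
  have c_C : (2 * pre_coef nu * odd_edge nu N)%:C =
      2 * (pre_coef nu)%:C * (odd_edge nu N)%:C.
    by rewrite !rmorphM /= rmorph_nat.
  rewrite kzE !cderiveE hlaguerre_horner -S_E c_E c_C n_E.
  have := sKernel_poly_identity tau nu N z w; by rewrite /laguerre_op -/t => ->.
Qed.
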